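(* Let $d\ge1$ and let $\mathbf X$ be a random vector in $\mathbb R^d$ with law $\mathbb P$ such that $\mathbb E\|\mathbf X\|<\infty$. Then for every $\delta>0$ there exist two constants $0<c_1<c_2$ such that $$c_1\|\mathbf z\|^{-1}\le D_\delta(\mathbf z|\mathbb P)\le c_2\|\mathbf z\|^{-1}$$ when $\|\mathbf z\|$ is large enough.
   Context: $\|\cdot\|$ is the Euclidean norm and $\langle\cdot,\cdot\rangle$ the Euclidean inner product. For laws $\mathbb P,\mathbb P'$ on $\mathbb R^d$ the Wasserstein distance is $d_W(\mathbb P,\mathbb P')=\inf_\Pi\int\|\mathbf x-\mathbf y\|\,\Pi(\mathrm d\mathbf x,\mathrm d\mathbf y)\in[0,\infty]$, over all joint laws $\Pi$ with marginals $\mathbb P,\mathbb P'$. The robustified halfspace depth is $$D_\delta(\mathbf z|\mathbb P)=\inf_{\|\mathbf u\|=1}\ \sup_{\mathbb P':d_W(\mathbb P',\mathbb P)\le\delta}\mathbb P'(\{\mathbf x\in\mathbb R^d:\langle\mathbf u,\mathbf x-\mathbf z\rangle\ge0\}).$$ *)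

(* Defs.v *)
From HB Require Import structures.
From mathcomp Require Import all_boot all_order all_algebra.
From mathcomp Require Import all_classical all_reals all_analysis.
Set Implicit Arguments.
Unset Strict Implicit.
Unset Printing Implicit Defensive.
Import Order.TTheory GRing.Theory Num.Theory.
Local Open Scope classical_set_scope.
Local Open Scope ring_scope.

(* R^d is d.-tuple R: its canonical sigma-algebra is the one generated by the
   coordinate maps, i.e. the Borel sigma-algebra of R^d.  (The norm that the
   library puts on row vectors is the sup norm, not the Euclidean one.) *)
Section euclidean_space.
Variables (R : realType) (d : nat).
Implicit Types x y : d.-tuple R.

Definition vsub x y : d.-tuple R := [tuple tnth x i - tnth y i | i < d].

Definition inner x y : R := \sum_(i < d) tnth x i * tnth y i.

Definition enorm x : R := Num.sqrt (inner x x).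

Definition halfspace (u z : d.-tuple R) : set (d.-tuple R) :=
  [set x | 0 <= inner u (vsub x z)].

End euclidean_space.

Section robust_depth.
Variables (R : realType) (d : nat).
Local Open Scope ereal_scope.

Definition coupling (P P' : probability (d.-tuple R) R) :
    set (probability (d.-tuple R * d.-tuple R)%type R) :=
  [set Pi | forall A : set (d.-tuple R), measurable A ->
    pushforward Pi fst A = P A /\ pushforward Pi snd A = P' A].

Definition wasserstein (P P' : probability (d.-tuple R) R) : \bar R :=
  ereal_inf [set \int[Pi]_w (enorm (vsub w.1 w.2))%:E | Pi in coupling P P'].

Definition robust_depth (delta : R) (P : probability (d.-tuple R) R)
    (z : d.-tuple R) : \bar R :=
  ereal_inf [set ereal_sup
      [set P' (halfspace u z) |
        P' in [set P' : probability (d.-tuple R) R |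
                 wasserstein P' P <= delta%:E]]
    | u in [set u : d.-tuple R | enorm u = 1%R]].

End robust_depth.

(* Main.v *)
Require Import Defs.
From HB Require Import structures.
From mathcomp Require Import all_boot all_order all_algebra.
From mathcomp Require Import ring lra.
From mathcomp Require Import all_classical all_reals all_analysis.
From mathcomp Require Import measurable_realfun.
Set Implicit Arguments.
Unset Strict Implicit.
Unset Printing Implicit Defensive.
Import Order.TTheory GRing.Theory Num.Theory.
Local Open Scope classical_set_scope.
Local Open Scope ring_scope.

(** A point [x] of the halfspace through [z] in the direction [u] of [z] has
    [|z| <= <u, x> <= |x|], so Markov's inequality bounds the mass that [P']
    gives to this halfspace by [E_P'|X| / |z|].  As the norm is 1-Lipschitz, so
    is the first moment for the Wasserstein distance, and the depth is at most
    [(delta + E_P|X|) / |z|].  For the lower bound, every halfspace through [z]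
    contains [z], and moving a fraction [p] of the mass of [P] to [z] costs at
    most [p (|z| + E_P|X|)], which is at most [delta] for
    [p = delta / (2 |z|)] as soon as [E_P|X| <= |z|]. *)

Section euclidean_space_theory.
Variables (R : realType) (d : nat).
Implicit Types (x y u z : d.-tuple R).

Lemma innerC x y : inner x y = inner y x.
Proof. by apply: eq_bigr => i _; rewrite mulrC. Qed.

Lemma innerBr u x y : inner u (vsub x y) = inner u x - inner u y.
Proof.
by rewrite /inner -sumrB; apply: eq_bigr => i _; rewrite tnth_mktuple mulrBr.
Qed.

Lemma innerxx_ge0 x : 0 <= inner x x.
Proof. by apply: sumr_ge0 => i _; rewrite -expr2 sqr_ge0. Qed.

Lemma enorm_ge0 x : 0 <= enorm x.
Proof. exact: sqrtr_ge0. Qed.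

Lemma enorm_sqr x : enorm x ^+ 2 = inner x x.
Proof. by rewrite sqr_sqrtr// innerxx_ge0. Qed.

Lemma enorm_vsubxx x : enorm (vsub x x) = 0.
Proof. by rewrite /enorm innerBr subrr sqrtr0. Qed.

Lemma CauchySchwarz_inner x y : inner x y ^+ 2 <= inner x x * inner y y.
Proof.
pose p := Poly [:: inner y y; 2 * inner x y; inner x x].
have p_sum_sqr t : p.[t] = \sum_(i < d) (t * tnth x i + tnth y i) ^+ 2.
  rewrite horner_Poly /= mul0r add0r /inner mulr_sumr mulr_suml -big_split /=.
  by rewrite mulr_suml -big_split; apply: eq_bigr => i _ /=; ring.
have p_ge0 t : 0 <= p.[t].
  by rewrite p_sum_sqr sumr_ge0// => i _; rewrite sqr_ge0.
have := @deg_le2_poly_ge0 _ p (size_Poly _) p_ge0.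
by rewrite !coefE /=; lra.
Qed.

Lemma normr_inner_le x y : `|inner x y| <= enorm x * enorm y.
Proof.
by rewrite -sqrtrM ?innerxx_ge0// -sqrtr_sqr ler_wsqrtr// CauchySchwarz_inner.
Qed.

Lemma inner_le x y : inner x y <= enorm x * enorm y.
Proof. exact: le_trans (ler_norm _) (normr_inner_le x y). Qed.

Lemma enorm_vsub_sqr x y :
  enorm (vsub x y) ^+ 2 = enorm x ^+ 2 - 2 * inner x y + enorm y ^+ 2.
Proof.
rewrite !enorm_sqr innerBr ![inner (vsub _ _) _]innerC !innerBr (innerC y x).
by ring.
Qed.

Lemma ler_enorm_vsub x y : enorm (vsub x y) <= enorm x + enorm y.
Proof.
rewrite -(@ler_pXn2r _ 2)// ?nnegrE ?addr_ge0 ?enorm_ge0// enorm_vsub_sqr.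
by have := normr_inner_le x y; rewrite ler_norml => /andP[]; lra.
Qed.

Lemma lerB_enorm_vsub x y : enorm x - enorm y <= enorm (vsub x y).
Proof.
apply: ler_normlW; rewrite -(@ler_pXn2r _ 2)// ?nnegrE ?enorm_ge0//.
by rewrite real_normK ?num_real// enorm_vsub_sqr; have := inner_le x y; lra.
Qed.

Lemma exists_unit_inner_enorm z : 0 < enorm z ->
  exists2 u, enorm u = 1 & inner u z = enorm z.
Proof.
move=> z0; pose u := [tuple (enorm z)^-1 * tnth z i | i < d].
have inner_u x : inner u x = (enorm z)^-1 * inner z x.
  rewrite /inner mulr_sumr; apply: eq_bigr => i _.
  by rewrite tnth_mktuple mulrA.
have uz : inner u z = enorm z.
  by rewrite inner_u -enorm_sqr expr2 mulKf ?gt_eqF.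
by exists u => //; rewrite /enorm inner_u innerC uz mulVf ?gt_eqF ?sqrtr1.
Qed.

Lemma halfspace_center u z : halfspace u z z.
Proof. by rewrite /halfspace /= innerBr subrr. Qed.

End euclidean_space_theory.

Section euclidean_space_measurability.
Variables (R : realType) (d : nat) (disp : measure_display).
Variable T : measurableType disp.
Implicit Types f g : T -> d.-tuple R.

Lemma measurable_fun_inner f g :
  measurable_fun setT f -> measurable_fun setT g ->
  measurable_fun setT (fun t => inner (f t) (g t)).
Proof.
move=> mf mg; apply: measurable_sum => i; apply: measurable_funM.
- exact: (measurableT_comp (measurable_tnth i) mf).
- exact: (measurableT_comp (measurable_tnth i) mg).
Qed.

Lemma measurable_fun_enorm f : measurable_fun setT f ->
  measurable_fun setT (fun t => enorm (f t)).
Proof.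
move=> mf; apply: (measurableT_comp (f := @Num.sqrt R)).
  by apply: continuous_measurable_fun; exact: sqrt_continuous.
exact: measurable_fun_inner.
Qed.

Lemma measurable_fun_vsub f g :
  measurable_fun setT f -> measurable_fun setT g ->
  measurable_fun setT (fun t => vsub (f t) (g t)).
Proof.
move=> mf mg; apply/measurable_fun_tnthP => i.
rewrite (_ : _ \o _ = fun t => tnth (f t) i - tnth (g t) i); last first.
  by apply/funext => t /=; rewrite tnth_mktuple.
apply: measurable_funB.
- exact: (measurableT_comp (measurable_tnth i) mf).
- exact: (measurableT_comp (measurable_tnth i) mg).
Qed.

End euclidean_space_measurability.

Lemma measurable_halfspace (R : realType) (d : nat) (u z : d.-tuple R) :
  measurable (halfspace u z).
Proof.
rewrite -[halfspace u z]setTI.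
have -> : halfspace u z = (fun x => inner u (vsub x z)) @^-1` `[0, +oo[%classic.
  by apply/seteqP; split => x; rewrite /halfspace /= in_itv /= andbT.
apply: measurable_fun_inner => //.
exact: (measurable_fun_vsub (f := id) (g := cst z)).
Qed.

Section mixture.
Variables (R : realType) (disp : measure_display) (T : measurableType disp).
Variables (p : {i01 R}) (P0 P1 : probability T R).
Local Open Scope ereal_scope.

Definition mixture : set T -> \bar R :=
  measure_add (mscale p%:num%:nng%R P0) (mscale (1 - p%:num)%:nng%R P1).

HB.instance Definition _ := Measure.on mixture.

Lemma mixtureE A : mixture A = p%:num%:E * P0 A + (1 - p%:num)%:E * P1 A.
Proof. exact: measure_addE. Qed.

Let mixture_setT : mixture setT = 1.
Proof. by rewrite mixtureE !probability_setT !mule1 -EFinD addrC subrK. Qed.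

HB.instance Definition _ :=
  Measure_isProbability.Build _ _ _ mixture mixture_setT.

Lemma ge0_integral_mixture (f : T -> \bar R) :
  measurable_fun setT f -> (forall x, 0 <= f x) ->
  \int[mixture]_x f x =
    p%:num%:E * \int[P0]_x f x + (1 - p%:num)%:E * \int[P1]_x f x.
Proof.
by move=> mf f0; rewrite ge0_integral_measure_add// !ge0_integral_mscale.
Qed.

End mixture.

Lemma mixturexx (R : realType) (disp : measure_display)
    (T : measurableType disp) (p : {i01 R}) (P : probability T R) (A : set T) :
  mixture p P P A = P A.
Proof.
rewrite mixtureE -ge0_muleDl ?lee_fin// ?subr_ge0//.
by rewrite -EFinD addrC subrK mul1e.
Qed.

Section diagonal.
Variables (disp : measure_display) (T : measurableType disp).

Definition diag (x : T) : T * T := (x, x).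

Lemma measurable_diag : measurable_fun setT diag.
Proof. exact: measurable_fun_pair. Qed.

HB.instance Definition _ := isMeasurableFun.Build _ _ _ _ diag measurable_diag.

End diagonal.

Section wasserstein_theory.
Variables (R : realType) (d : nat).
Local Notation E := (d.-tuple R).
Implicit Types (P : probability E R) (Pi : probability (E * E)%type R).
Local Open Scope ereal_scope.

Definition first_moment P : \bar R := \int[P]_x (enorm x)%:E.

Definition transport_cost Pi : \bar R := \int[Pi]_w (enorm (vsub w.1 w.2))%:E.

Let enormE_ge0 (x : E) : 0 <= (enorm x)%:E :> \bar R.
Proof. by rewrite lee_fin enorm_ge0. Qed.
#[local] Hint Resolve enormE_ge0 : core.

Lemma measurable_EFin_enorm : measurable_fun setT (fun x : E => (enorm x)%:E).
Proof. exact/measurable_EFinP/measurable_fun_enorm. Qed.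

Lemma measurable_EFin_enorm_vsub :
  measurable_fun setT (fun w : E * E => (enorm (vsub w.1 w.2))%:E).
Proof. exact/measurable_EFinP/measurable_fun_enorm/measurable_fun_vsub. Qed.

Lemma first_moment_ge0 P : 0 <= first_moment P.
Proof. exact: integral_ge0. Qed.

Lemma first_moment_dirac (z : E) : first_moment \d_z = (enorm z)%:E.
Proof.
rewrite /first_moment integral_dirac ?diracT ?mul1e//.
exact: measurable_EFin_enorm.
Qed.

Lemma first_moment_distribution (disp : measure_display)
    (Omega : measurableType disp) (Q : probability Omega R)
    (X : {RV Q >-> E}) :
  first_moment (distribution Q X) = 'E_Q[fun w => enorm (X w)].
Proof.
rewrite unlock /first_moment ge0_integral_distribution//.
exact: measurable_EFin_enorm.
Qed.

Lemma markov_halfspace P (u z : E) : enorm u = 1%R -> (0 < inner u z)%R ->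
  (inner u z)%:E * P (halfspace u z) <= first_moment P.
Proof.
move=> u1 uz0.
have menorm := measurable_EFin_enorm.
have halfspace_le : halfspace u z `<=`
    setT `&` [set x | (inner u z)%:E <= `|(enorm x)%:E|].
  move=> x; rewrite /halfspace /= innerBr subr_ge0 => uzx; split => //.
  rewrite lee_fin ger0_norm ?enorm_ge0// (le_trans uzx)//.
  by have := inner_le u x; rewrite u1 mul1r.
have -> : first_moment P = \int[P]_x `|(enorm x)%:E|.
  by apply: eq_integral => x _ /=; rewrite ger0_norm// enorm_ge0.
apply: le_trans (le_integral_abse P measurableT menorm uz0).
rewrite lee_pmul2l//; apply: le_measure halfspace_le; rewrite inE.
  exact: measurable_halfspace.
by apply: emeasurable_fun_c_infty => //; exact: measurableT_comp.
Qed.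

Lemma transport_cost_ge0 Pi : 0 <= transport_cost Pi.
Proof. exact: integral_ge0. Qed.

Lemma wasserstein_ge0 P P' : 0 <= wasserstein P P'.
Proof. by apply/ereal_infP => _ [Pi _ <-]; exact: transport_cost_ge0. Qed.

Lemma wasserstein_le_cost P P' Pi :
  coupling P P' Pi -> wasserstein P P' <= transport_cost Pi.
Proof. by move=> cPi; apply: ereal_inf_lbound; exists Pi. Qed.

Lemma coupling_diag P : coupling P P (distribution P (@diag _ E)).
Proof. by []. Qed.

Lemma transport_cost_diag P : transport_cost (distribution P (@diag _ E)) = 0.
Proof.
rewrite /transport_cost ge0_integral_distribution//.
- by apply: integral0_eq => x _ /=; rewrite enorm_vsubxx.
- exact: measurable_EFin_enorm_vsub.
Qed.

Lemma coupling_product P P' : coupling P P' (P \x P').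
Proof.
move=> A mA; split; rewrite /pushforward.
- rewrite -[RHS]mule1 -(probability_setT P') -setXT.
  exact: product_measure1E.
- rewrite -[RHS]mul1e -(probability_setT P) -setTX.
  exact: product_measure1E.
Qed.

Lemma coupling_mixture (p : {i01 R}) P0 P0' Pi0 P1 P1' Pi1 :
  coupling P0 P0' Pi0 -> coupling P1 P1' Pi1 ->
  coupling (mixture p P0 P1) (mixture p P0' P1') (mixture p Pi0 Pi1).
Proof.
move=> cPi0 cPi1 A mA.
have [fst0 snd0] := cPi0 A mA; have [fst1 snd1] := cPi1 A mA.
by rewrite /pushforward /= !mixtureE -fst0 -fst1 -snd0 -snd1.
Qed.

Section coupling_integral.
Variables (P P' : probability E R) (Pi : probability (E * E)%type R).
Hypothesis cPi : coupling P P' Pi.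

Lemma ge0_integral_coupling_fst (f : E -> \bar R) :
  measurable_fun setT f -> (forall x, 0 <= f x) ->
  \int[Pi]_w f w.1 = \int[P]_x f x.
Proof.
move=> mf f0; transitivity (\int[pushforward Pi fst]_x f x).
  by rewrite ge0_integral_pushforward.
by apply: eq_measure_integral => A mA _; have [] := cPi mA.
Qed.

Lemma ge0_integral_coupling_snd (f : E -> \bar R) :
  measurable_fun setT f -> (forall x, 0 <= f x) ->
  \int[Pi]_w f w.2 = \int[P']_x f x.
Proof.
move=> mf f0; transitivity (\int[pushforward Pi snd]_x f x).
  by rewrite ge0_integral_pushforward.
by apply: eq_measure_integral => A mA _; have [] := cPi mA.
Qed.

Lemma transport_cost_le : transport_cost Pi <= first_moment P + first_moment P'.
Proof.
have menorm1 : measurable_fun setT (fun w : E * E => (enorm w.1)%:E).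
  exact: measurableT_comp measurable_EFin_enorm measurable_fst.
have menorm2 : measurable_fun setT (fun w : E * E => (enorm w.2)%:E).
  exact: measurableT_comp measurable_EFin_enorm measurable_snd.
rewrite /first_moment -(ge0_integral_coupling_fst measurable_EFin_enorm)//.
rewrite -(ge0_integral_coupling_snd measurable_EFin_enorm)// -ge0_integralD//.
apply: ge0_le_integral => //.
- exact: measurable_EFin_enorm_vsub.
- exact: emeasurable_funD.
- by move=> w _; rewrite -EFinD lee_fin ler_enorm_vsub.
Qed.

Lemma ge0_integral_le_transport_cost (f : E -> R) :
    measurable_fun setT f -> (forall x, 0 <= f x)%R ->
    (forall x y, f x - f y <= enorm (vsub x y))%R ->
  \int[P]_x (f x)%:E <= transport_cost Pi + \int[P']_x (f x)%:E.
Proof.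
move=> mf f0 f_lip.
have fE0 x : 0 <= (f x)%:E by rewrite lee_fin.
have mfE : measurable_fun setT (fun x => (f x)%:E) by exact/measurable_EFinP.
have mf1 : measurable_fun setT (fun w : E * E => (f w.1)%:E).
  exact: measurableT_comp mfE measurable_fst.
have mf2 : measurable_fun setT (fun w : E * E => (f w.2)%:E).
  exact: measurableT_comp mfE measurable_snd.
rewrite -(ge0_integral_coupling_fst mfE)// -(ge0_integral_coupling_snd mfE)//.
rewrite -ge0_integralD//; last exact: measurable_EFin_enorm_vsub.
apply: ge0_le_integral => //.
- by apply: emeasurable_funD => //; exact: measurable_EFin_enorm_vsub.
- by move=> w _; rewrite -EFinD lee_fin -lerBlDr f_lip.
Qed.

End coupling_integral.

Lemma ge0_integral_le_wasserstein P P' (f : E -> R) :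
    measurable_fun setT f -> (forall x, 0 <= f x)%R ->
    (forall x y, f x - f y <= enorm (vsub x y))%R ->
  \int[P]_x (f x)%:E <= wasserstein P P' + \int[P']_x (f x)%:E.
Proof.
move=> mf f0 f_lip.
have int_ge0 : 0 <= \int[P']_x (f x)%:E.
  by apply: integral_ge0 => x _; rewrite lee_fin.
have [->|int_fin] := eqVneq (\int[P']_x (f x)%:E) +oo.
  by rewrite addey ?leey// gt_eqF// (lt_le_trans _ (wasserstein_ge0 _ _)).
rewrite -leeBlDr ?ge0_fin_numE ?ltey//.
apply/ereal_infP => _ [Pi cPi <-].
by rewrite leeBlDr ?ge0_fin_numE ?ltey// ge0_integral_le_transport_cost.
Qed.

Lemma first_moment_le_wasserstein P P' :
  first_moment P <= wasserstein P P' + first_moment P'.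
Proof.
apply: ge0_integral_le_wasserstein.
- exact: measurable_fun_enorm.
- exact: enorm_ge0.
- exact: lerB_enorm_vsub.
Qed.

Lemma wasserstein_le_first_moment P P' :
  wasserstein P P' <= first_moment P + first_moment P'.
Proof.
have cP := coupling_product P P'.
exact: le_trans (wasserstein_le_cost cP) (transport_cost_le cP).
Qed.

Lemma wasserstein_mixture_le_cost (p : {i01 R}) P P' Pi :
    coupling P' P Pi ->
  wasserstein (mixture p P' P) P <= p%:num%:E * transport_cost Pi.
Proof.
move=> cPi; pose Pi_diag := mixture p Pi (distribution P (@diag _ E)).
have cPi_diag : coupling (mixture p P' P) P Pi_diag.
  move=> A mA; rewrite -[P A](mixturexx p).
  exact: coupling_mixture cPi (coupling_diag P) A mA.
apply: le_trans (wasserstein_le_cost cPi_diag) _.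
rewrite [leLHS]ge0_integral_mixture//; last exact: measurable_EFin_enorm_vsub.
by rewrite -!/(transport_cost _) transport_cost_diag mule0 adde0.
Qed.

Lemma wasserstein_mixture_le (p : {i01 R}) P P' :
  wasserstein (mixture p P' P) P <= p%:num%:E * wasserstein P' P.
Proof.
have : (0 <= p%:num :> R)%R by [].
rewrite le_eqVlt => /predU1P[p0|p_gt0].
  have := wasserstein_mixture_le_cost p (coupling_product P' P).
  by rewrite -p0 !mul0e.
rewrite -ereal_inf_pZl//; apply/ereal_infP => _ [_ [Pi cPi <-] <-].
exact: wasserstein_mixture_le_cost.
Qed.

End wasserstein_theory.

Section robust_depth_bounds.
Variables (R : realType) (d : nat) (delta : R).
Variables (P : probability (d.-tuple R) R) (z : d.-tuple R).
Local Open Scope ereal_scope.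

Lemma robust_depth_le : (0 < enorm z)%R ->
  (enorm z)%:E * robust_depth delta P z <= delta%:E + first_moment P.
Proof.
move=> z0; have [u u1 uz] := exists_unit_inner_enorm z0.
rewrite -lee_pdivlMl//.
apply: le_trans; first by apply: ereal_inf_lbound; exists u; [exact: u1|].
apply/ereal_supP => _ [P' /= P'_near <-]; rewrite lee_pdivlMl// -uz.
apply: le_trans (markov_halfspace _ _ _) _; rewrite ?uz//.
by apply: le_trans (first_moment_le_wasserstein P' P) _; exact: leeD2r.
Qed.

Lemma robust_depth_ge (p : {i01 R}) :
    p%:num%:E * wasserstein \d_z P <= delta%:E ->
  p%:num%:E <= robust_depth delta P z.
Proof.
move=> cost_le; apply/ereal_infP => _ [u _ <-].
apply: (@le_trans _ _ (mixture p \d_z P (halfspace u z))).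
  rewrite mixtureE /= diracE mem_set ?mule1; last exact: halfspace_center.
  by rewrite leeDl// mule_ge0// lee_fin subr_ge0.
apply: ereal_sup_ubound; exists (mixture p \d_z P) => //=.
exact: le_trans (wasserstein_mixture_le _ _ _) cost_le.
Qed.

End robust_depth_bounds.

Theorem corollary2 (R : realType) (d : nat) (hd : (1 <= d)%N)
    (disp : measure_display) (Omega : measurableType disp)
    (Q : probability Omega R) (X : {RV Q >-> d.-tuple R})
    (hX : ('E_Q[fun w => enorm (X w)] < +oo)%E)
    (delta : R) (hdelta : 0 < delta) :
  exists c1 c2 : R,
    [/\ 0 < c1, c1 < c2 &
      exists r : R, forall z : d.-tuple R, r <= enorm z ->
        ((c1 * (enorm z)^-1)%:E <= robust_depth delta (distribution Q X) z /\
         robust_depth delta (distribution Q X) z <= (c2 * (enorm z)^-1)%:E)%E].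
Proof.
set P := distribution Q X.
have [m mE] : exists m, first_moment P = m%:E.
  exists (fine (first_moment P)).
  by rewrite fineK// ge0_fin_numE ?first_moment_ge0// first_moment_distribution.
have m0 : 0 <= m by rewrite -lee_fin -mE first_moment_ge0.
exists (delta / 2), (delta + m); split; [lra|lra|].
exists (delta + m) => z z_large; have z0 : 0 < enorm z by lra.
split.
- have p0 : 0 <= delta / 2 / enorm z by rewrite !divr_ge0 ?ltW.
  have p1 : delta / 2 / enorm z <= 1 by rewrite ler_pdivrMr//; lra.
  apply: (@robust_depth_ge _ _ _ _ _ (Itv01 p0 p1)).
  apply: le_trans (lee_wpmul2l _ (wasserstein_le_first_moment _ _)) _ => //.
  rewrite first_moment_dirac mE -EFinD -EFinM lee_fin /= mulrAC ler_pdivrMr//.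
  by nra.
- rewrite mulrC EFinM lee_pdivlMl// EFinD -mE.
  exact: robust_depth_le.
Qed.
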